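(* Let $\nu\ge 2$, let $\mathcal{X}=\{0,1\}^\nu$, and consider the generalized linear model with $\boldsymbol{f}(\boldsymbol{x})=(1,x_1,\dots,x_\nu)^{\mathsf T}$ for $\boldsymbol{x}=(x_1,\dots,x_\nu)^{\mathsf T}\in\mathcal{X}$. Denote $\boldsymbol{x}_1^*=(0,\dots,0)^{\mathsf T}$ and, for $1\le i\le\nu$, let $\boldsymbol{x}_{i+1}^*$ be the $i$-th unit vector of $\mathbb{R}^\nu$ (so $\boldsymbol{x}_2^*=(1,0,\dots,0)^{\mathsf T},\dots,\boldsymbol{x}_{\nu+1}^*=(0,\dots,0,1)^{\mathsf T}$). For a given parameter point $\boldsymbol{\beta}=(\beta_0,\beta_1,\dots,\beta_\nu)^{\mathsf T}$ let $u_i=u(\boldsymbol{x}_i^*,\boldsymbol{\beta})$ for $1\le i\le\nu+1$. Then the design $\xi^*$ which assigns equal weights $1/(\nu+1)$ to the design points $\boldsymbol{x}_i^*$, $1\le i\le\nu+1$, is locally D-optimal (at $\boldsymbol{\beta}$) if and only if $$u_1^{-1}\Bigl(1-\sum_{j=1}^\nu x_j\Bigr)^2+\sum_{i=1}^\nu u_{i+1}^{-1}x_i^2\le u^{-1}(\boldsymbol{x},\boldsymbol{\beta})\quad\text{for all }\boldsymbol{x}=(x_1,\dots,x_\nu)^{\mathsf T}\in\{0,1\}^\nu .$$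
   Context: Here $u^{-1}(\boldsymbol{x},\boldsymbol{\beta})=1/u(\boldsymbol{x},\boldsymbol{\beta})$. Setting: $\mathcal{X}\subseteq\mathbb{R}^\nu$ is the experimental region, $\boldsymbol{f}:\mathcal{X}\to\mathbb{R}^p$ is the regression function and $\boldsymbol{\beta}\in\mathbb{R}^p$ the parameter vector (here $p=\nu+1$). The intensity function $u(\boldsymbol{x},\boldsymbol{\beta})$ of the generalized linear model is a positive function which depends on $(\boldsymbol{x},\boldsymbol{\beta})$ only through the value of the linear predictor $\boldsymbol{f}^{\mathsf T}(\boldsymbol{x})\boldsymbol{\beta}$ (it is $u=(\mathrm{var}(Y)(\mathrm{d}\eta/\mathrm{d}\mu)^2)^{-1}$, where $\eta=g(\mu)=\boldsymbol{f}^{\mathsf T}(\boldsymbol{x})\boldsymbol{\beta}$, $\mu$ is the mean of the response $Y$ and $g$ the link function). A design $\xi$ is a probability measure with finite support on $\mathcal{X}$, given by pairwise distinct support points $\boldsymbol{x}_1,\dots,\boldsymbol{x}_r\in\mathcal{X}$ with weights $\omega_1,\dots,\omega_r>0$, $\sum_i\omega_i=1$. Its information matrix at $\boldsymbol{\beta}$ is $\boldsymbol{M}(\xi,\boldsymbol{\beta})=\sum_{i=1}^r\omega_i\,u(\boldsymbol{x}_i,\boldsymbol{\beta})\,\boldsymbol{f}(\boldsymbol{x}_i)\boldsymbol{f}^{\mathsf T}(\boldsymbol{x}_i)$. A design is locally D-optimal (at $\boldsymbol{\beta}$) if it minimizes $\det(\boldsymbol{M}^{-1}(\xi,\boldsymbol{\beta}))$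 (equivalently, maximizes $\det\boldsymbol{M}(\xi,\boldsymbol{\beta})$) over all designs $\xi$ on $\mathcal{X}$ whose information matrix is nonsingular. *)

(* Defs.v *)
From HB Require Import structures.
From mathcomp Require Import all_boot all_order all_algebra.
From mathcomp Require Import reals.
Set Implicit Arguments.
Unset Strict Implicit.
Unset Printing Implicit Defensive.
Import Order.TTheory GRing.Theory Num.Theory.
Local Open Scope ring_scope.

Definition linear_predictor (R : realType) (nu p : nat)
    (f : 'cV[R]_nu -> 'cV[R]_p) (x : 'cV[R]_nu) (beta : 'cV[R]_p) : R :=
  ((f x)^T *m beta) 0 0.

(* [u] is a total function, but only its values on the experimental region [X]
   are constrained (and only these enter the information matrices). *)
Definition glm_intensity (R : realType) (nu p : nat) (X : {pred 'cV[R]_nu})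
    (f : 'cV[R]_nu -> 'cV[R]_p) (u : 'cV[R]_nu -> 'cV[R]_p -> R) : Prop :=
  (forall x beta, x \in X -> 0 < u x beta) /\
  (forall x x' beta beta', x \in X -> x' \in X ->
     linear_predictor f x beta = linear_predictor f x' beta' ->
     u x beta = u x' beta').

Record design (R : realType) (nu : nat) (X : {pred 'cV[R]_nu}) := Design {
  design_size : nat;
  design_point : 'I_design_size -> 'cV[R]_nu;
  design_weight : 'I_design_size -> R;
  design_point_inj : injective design_point;
  design_point_in : forall i, design_point i \in X;
  design_weight_gt0 : forall i, 0 < design_weight i;
  design_weight_sum : \sum_i design_weight i = 1 }.

Arguments design_point {R nu X} d i.
Arguments design_weight {R nu X} d i.

Definition info_matrix (R : realType) (nu p : nat) (X : {pred 'cV[R]_nu})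
    (f : 'cV[R]_nu -> 'cV[R]_p) (u : 'cV[R]_nu -> 'cV[R]_p -> R)
    (xi : design X) (beta : 'cV[R]_p) : 'M[R]_p :=
  \sum_i (design_weight xi i * u (design_point xi i) beta) *:
    (f (design_point xi i) *m (f (design_point xi i))^T).

Definition locally_D_optimal (R : realType) (nu p : nat)
    (X : {pred 'cV[R]_nu}) (f : 'cV[R]_nu -> 'cV[R]_p)
    (u : 'cV[R]_nu -> 'cV[R]_p -> R) (beta : 'cV[R]_p) (xi : design X) : Prop :=
  info_matrix f u xi beta \in unitmx /\
  (forall xi' : design X, info_matrix f u xi' beta \in unitmx ->
     \det (invmx (info_matrix f u xi beta))
       <= \det (invmx (info_matrix f u xi' beta))).

Definition hypercube (R : realType) (nu : nat) : {pred 'cV[R]_nu} :=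
  [pred x : 'cV[R]_nu | [forall i, (x i 0 == 0) || (x i 0 == 1)]].

Arguments hypercube R nu : clear implicits.

Definition first_order_regression (R : realType) (nu : nat) (x : 'cV[R]_nu) :
    'cV[R]_(1 + nu) :=
  col_mx (const_mx 1) x.

(* Indexed from 0: the origin at [ord0], the [j]-th unit vector at
   [lift ord0 j]. *)
Definition xstar (R : realType) (nu : nat) (i : 'I_nu.+1) : 'cV[R]_nu :=
  if unlift ord0 i is Some j then delta_mx j 0 else 0.

Arguments xstar R {nu} i.

Lemma xstar_inj (R : realType) (nu : nat) : injective (@xstar R nu).
Proof.
move=> i k; rewrite /xstar.
case: (unliftP ord0 i) => [j ->|->]; case: (unliftP ord0 k) => [l ->|->] //.
- move=> /matrixP/(_ j 0); rewrite !mxE !eqxx andbT /=.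
  by case: eqP => [->//|_] /eqP; rewrite oner_eq0.
- by move=> /matrixP/(_ j 0) /eqP; rewrite !mxE !eqxx oner_eq0.
- by move=> /matrixP/(_ l 0) /esym/eqP; rewrite !mxE !eqxx oner_eq0.
Qed.

Lemma xstar_in (R : realType) (nu : nat) (i : 'I_nu.+1) :
  xstar R i \in hypercube R nu.
Proof.
rewrite inE; apply/forallP => l; rewrite /xstar.
case: (unliftP ord0 i) => [j _|_]; rewrite mxE ?eqxx // andbT.
by case: (l == j); rewrite eqxx ?orbT.
Qed.

Lemma equal_weight_gt0 (R : realType) (nu : nat) (i : 'I_nu.+1) :
  0 < (nu.+1%:R : R)^-1.
Proof. by rewrite invr_gt0 ltr0n. Qed.

Lemma equal_weight_sum (R : realType) (nu : nat) :
  \sum_(i < nu.+1) (nu.+1%:R : R)^-1 = 1.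
Proof. by rewrite sumr_const card_ord -[LHS]mulr_natr mulVf // pnatr_eq0. Qed.

Definition xi_star (R : realType) (nu : nat) : design (hypercube R nu) :=
  @Design R nu (hypercube R nu) nu.+1 (@xstar R nu) (fun=> nu.+1%:R^-1)
    (@xstar_inj R nu) (@xstar_in R nu)
    (@equal_weight_gt0 R nu) (@equal_weight_sum R nu).

(* Main.v *)
Require Import Defs.
From mathcomp Require Import all_boot all_order all_algebra.
From mathcomp Require Import reals.
From mathcomp Require Import ring lra.
Import Order.TTheory GRing.Theory Num.Theory.
Local Open Scope ring_scope.

(** Write [p = nu + 1], [x_i = xstar R i] for [i < p] and [u_i = u (x_i, beta)].
The points [x_i] are the vertices of a simplex, so every [x] has barycentric
coordinates [c(x) = (1 - \sum_j x_j, x_1, ..., x_nu)] with respect to them, and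
[f(x) = F c(x)] for one matrix [F], the same for all [x], with [\det F = 1]
([first_order_regressionE]).  Hence [M(xi) = F N(xi) F^T], where [N(xi)] is the
information matrix of the regression function [c]; both have the same
determinant, and [N(xi_star)] is the diagonal matrix with entries [u_i / p].
In these coordinates the left-hand side of the inequality is
[s(x) = \sum_i c_i(x)^2 / u_i], so the condition reads [u(x) s(x) <= 1].

Sufficiency is a direct estimate.  For a design with points [y_k] and weights
[w_k], the matrix [N = N(xi)] is positive semidefinite, so Hadamard's inequality
([hadamard_inequality]) gives [\det N <= \prod_i N_ii].  Dividing each [N_ii] by
[u_i], the condition yields [\sum_i N_ii / u_i = \sum_k w_k u(y_k) s(y_k) <= 1],
and the inequality of the means bounds [\prod_i N_ii / u_i] by [p^-p].  Together,
[\det N <= \prod_i u_i / p = \det N(xi_star)] ([det_info_matrix_le]).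

Necessity is a one-point perturbation.  If [d = u(x) s(x) > 1], then [x] is not
one of the vertices, because there [u(x) s(x) = 1].  Moving a mass [e] from
[xi_star] to [x] adds a rank one matrix to a diagonal one, and the determinant of
the sum ([det_diag_add_rank1]) is that of [N(xi_star)] multiplied by
[(1 - e)^p (1 + e p d / (1 - e))].  The derivative of this factor at [e = 0] is
[p (d - 1) > 0], and an explicit [e] makes the factor exceed one
([exists_det_increase]), which contradicts optimality. *)

(** * Positive semidefinite matrices and Hadamard's inequality *)
Definition psd {R : realFieldType} {n : nat} (A : 'M[R]_n) : Prop :=
  A^T = A /\ forall v : 'cV[R]_n, 0 <= (v^T *m A *m v) 0 0.

Lemma psd_congruence {R : realFieldType} {m n : nat} (A : 'M[R]_n)
    (P : 'M[R]_(n, m)) : psd A -> psd (P^T *m A *m P).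
Proof.
move=> [symA posA]; split; first by rewrite !trmx_mul trmxK symA mulmxA.
by move=> v; have := posA (P *m v); rewrite trmx_mul !mulmxA.
Qed.

Lemma psd_diag_ge0 {R : realFieldType} {n : nat} (A : 'M[R]_n) (i : 'I_n) :
  psd A -> 0 <= A i i.
Proof.
by move=> [_ /(_ (delta_mx i 0))]; rewrite trmx_delta -rowE -colE !mxE.
Qed.

(** Along the line [t e_i + e_j] the quadratic form is affine in [t] when the
diagonal entry at [i] vanishes; being nonnegative, it has slope zero. *)
Lemma psd_row_eq0 {R : realFieldType} {n : nat} (A : 'M[R]_n) (i j : 'I_n) :
  psd A -> A i i = 0 -> A i j = 0.
Proof.
move=> [symA posA] Aii0; have Aji : A j i = A i j by rewrite -[in LHS]symA mxE.
have line t : 0 <= 2 * t * A i j + A j j.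
  have := posA (t *: delta_mx i 0 + delta_mx j 0).
  have -> : (t *: delta_mx i 0 + delta_mx j 0 : 'cV[R]_n)^T
      = t *: delta_mx 0 i + delta_mx 0 j.
    by apply/matrixP => k l; rewrite !mxE !(andbC (l == _)).
  rewrite !(mulmxDl, mulmxDr).
  rewrite -!(scalemxAl, scalemxAr) -!rowE -!colE !mxE Aii0 Aji.
  by congr (_ <= _); ring.
apply/eqP/negP => /negP Aij0.
(* This value of [t] makes the form equal to -1. *)
have := line (- (A j j + 1) / (2 * A i j)).
rewrite leNgt => /negP; apply.
suff -> : 2 * (- (A j j + 1) / (2 * A i j)) * A i j + A j j = -1.
  by rewrite ltrN10.
by field; rewrite Aij0.
Qed.

(** Induction on the size.  If the first diagonal entry [a] is zero, so is the
first row, and both bounds are trivial.  Otherwise one step of elimination gives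
[\det A = a \det S] for the Schur complement [S], which is again positive
semidefinite, and whose diagonal entries are those of [A] minus squares over
[a]. *)
Lemma hadamard_inequality {R : realFieldType} {n : nat} (A : 'M[R]_n) :
  psd A -> 0 <= \det A <= \prod_i A i i.
Proof.
elim: n A => [|n IHn] A psdA; first by rewrite det_mx00 big_ord0 ler01 lexx.
have [a0|a_neq0] := eqVneq (A ord0 ord0) 0.
  rewrite [\prod_i _]big_ord_recl a0 mul0r (expand_det_row _ ord0).
  by rewrite big1 ?lexx // => j _; rewrite psd_row_eq0 ?mul0r.
have a_gt0 : 0 < A ord0 ord0 by rewrite lt_def a_neq0 psd_diag_ge0.
set a := A ord0 ord0 in a_neq0 a_gt0.
pose B : 'M[R]_(1 + n) := A; pose b := ursubmx B.
pose S := drsubmx B - a^-1 *: (b^T *m b).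
have defB : B = block_mx a%:M b b^T (drsubmx B).
  rewrite -[LHS]submxK; congr block_mx.
    rewrite [LHS]mx11_scalar; congr (_%:M); rewrite !mxE.
    by congr (A _ _); apply/val_inj.
  by rewrite /b trmx_ursub; case: psdA => ->.
(* The columns of [P] are the combinations of columns that clear the first row
   of [A]; restricting the quadratic form of [A] to their span gives [S]. *)
pose P : 'M[R]_(1 + n, n) := col_mx (- a^-1 *: b) 1%:M.
have BP : B *m P = col_mx 0 S.
  rewrite defB mul_block_col !mulmx1 mul_scalar_mx scalerA mulrN mulfV //.
  by rewrite scaleN1r addNr -scalemxAr scaleNr addrC.
have psdS : psd S.
  have -> : S = P^T *m B *m P.
    rewrite -mulmxA BP tr_col_mx mul_row_col mulmx0 add0r.
    by rewrite trmx1 mul1mx.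
  exact: psd_congruence psdA.
have detA : \det A = a * \det S.
  have -> : \det A = \det (B *m row_mx (col_mx 1%:M 0) P).
    by rewrite det_mulmx -block_mxEh det_ublock !det1 !mulr1.
  rewrite mul_mx_row BP {1}defB mul_block_col !mulmx1 !mulmx0 !addr0.
  by rewrite -block_mxEh det_lblock det_scalar1.
have /andP[detS_ge0 detS_le] := IHn S psdS.
rewrite detA mulr_ge0 ?(ltW a_gt0) //=.
rewrite big_ord_recl -/a ler_wpM2l ?(ltW a_gt0) //.
apply: le_trans detS_le _; apply: ler_prod => i _.
rewrite psd_diag_ge0 //= /S !mxE big_ord1 !mxE.
have -> : A (lift ord0 i) (lift ord0 i) = B (rshift 1 i) (rshift 1 i).
  by congr (A _ _); apply/val_inj.
by rewrite lerBlDr lerDl mulr_ge0 ?invr_ge0 ?(ltW a_gt0) // -expr2 sqr_ge0.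
Qed.

(** * Rank one updates of determinants *)

(** Multiplying [[1, -y], [x, 1]] by [[1, y], [0, 1]] on the right or on the left
makes it block triangular, with the one or the other side as determinant. *)
Lemma det_one_add_rank1 {R : comPzRingType} {n : nat} (x : 'cV[R]_n)
    (y : 'rV[R]_n) : \det (1%:M + x *m y) = 1 + (y *m x) 0 0.
Proof.
have <- : \det (block_mx (1%:M : 'M[R]_1) (- y) x 1%:M) = \det (1%:M + x *m y).
  have := det_mulmx (block_mx (1%:M : 'M[R]_1) (- y) x 1%:M)
    (block_mx 1%:M y 0 1%:M).
  rewrite mulmx_block !det_ublock !det1 !mulr1 !mulmx0 !addr0 !mulmx1 mul1mx.
  by rewrite subrr det_lblock det1 mul1r [x *m y + _]addrC => <-.
have := det_mulmx (block_mx 1%:M y 0 (1%:M : 'M[R]_n))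
  (block_mx (1%:M : 'M[R]_1) (- y) x 1%:M).
rewrite mulmx_block !det_ublock !det1 !mul1r !mul0mx !add0r !mulmx1 !mul1mx.
by rewrite addNr det_lblock det1 mulr1 det_mx11 => <-; rewrite !mxE.
Qed.

Lemma det_diag_add_rank1 {R : fieldType} {n : nat} (a : 'rV[R]_n)
    (c : 'cV[R]_n) (b : R) : (forall i, a 0 i != 0) ->
  \det (diag_mx a + b *: (c *m c^T))
    = (\prod_i a 0 i) * (1 + b * \sum_i (a 0 i)^-1 * c i 0 ^+ 2).
Proof.
move=> a_neq0; pose x : 'cV[R]_n := \col_i (b * (a 0 i)^-1 * c i 0).
have -> : diag_mx a + b *: (c *m c^T) = diag_mx a *m (1%:M + x *m c^T).
  rewrite mulmxDr mulmx1; congr (_ + _); rewrite mul_diag_mx.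
  apply/matrixP => i j; rewrite !mxE !big_ord1 !mxE.
  by field; rewrite a_neq0.
rewrite det_mulmx det_diag det_one_add_rank1; congr (_ * (1 + _)).
rewrite mxE mulr_sumr; apply: eq_bigr => i _; rewrite !mxE; ring.
Qed.

(** * Barycentric coordinates with respect to the vertices of the simplex *)
Definition barycentric {R : realType} {nu : nat} (x : 'cV[R]_nu) :
    'cV[R]_(1 + nu) :=
  col_mx (1 - \sum_(j < nu) x j 0)%:M x.

(** The columns are the regression vectors of the points [xstar R i]. *)
Definition simplex_mx (R : realType) (nu : nat) : 'M[R]_(1 + nu) :=
  block_mx 1%:M (const_mx 1) 0 1%:M.

Lemma det_simplex_mx (R : realType) (nu : nat) : \det (simplex_mx R nu) = 1.
Proof. by rewrite det_ublock !det1 mulr1. Qed.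

Lemma first_order_regressionE {R : realType} {nu : nat} (x : 'cV[R]_nu) :
  first_order_regression x = simplex_mx R nu *m barycentric x.
Proof.
rewrite mul_block_col !mul1mx mul0mx add0r; congr col_mx.
apply/matrixP => i j; rewrite !ord1 !mxE /=.
rewrite [X in _ + X](eq_bigr (fun k => x k 0)); last first.
  by move=> k _; rewrite !mxE mul1r.
by rewrite mulr1n subrK.
Qed.

Lemma barycentric_xstar {R : realType} {nu : nat} (i : 'I_nu.+1) :
  barycentric (xstar R i) = delta_mx i 0 :> 'cV[R]_(1 + nu).
Proof.
rewrite /barycentric /xstar; case: (unliftP ord0 i) => [j ->|->].
  rewrite (bigD1 j) //= big1 => [|k /negPf kj]; last by rewrite !mxE kj.
  rewrite !mxE !eqxx addr0 subrr.
  apply/matrixP => k l; rewrite !mxE; case: (splitP k) => k' kE.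
    rewrite !mxE !ord1 (_ : k = ord0) ?mul0rn //.
    by apply/val_inj; rewrite /= kE ord1.
  rewrite !mxE (_ : k = lift ord0 k') ?(inj_eq (@lift_inj _ _)) //.
  exact/val_inj.
rewrite big1 => [|k _]; last by rewrite mxE.
apply/matrixP => k l; rewrite !mxE subr0; case: (splitP k) => k' kE.
  rewrite !mxE !ord1 (_ : k = ord0) //.
  by apply/val_inj; rewrite /= kE ord1.
by rewrite !mxE (_ : k = lift ord0 k') //; exact/val_inj.
Qed.

Lemma sum_inv_barycentric {R : realType} {nu : nat} (a : 'I_nu.+1 -> R)
    (x : 'cV[R]_nu) :
  \sum_(i < nu.+1) (a i)^-1 * barycentric x i 0 ^+ 2
    = (a ord0)^-1 * (1 - \sum_(j < nu) x j 0) ^+ 2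
      + \sum_(i < nu) (a (lift ord0 i))^-1 * x i 0 ^+ 2.
Proof.
rewrite big_ord_recl; congr (_ * _ ^+ 2 + _).
  have -> : @ord0 nu = lshift nu (@ord0 0) by exact/val_inj.
  by rewrite col_mxEu mxE mulr1n.
apply: eq_bigr => i _; congr (_ * _ ^+ 2).
rewrite (_ : lift ord0 i = rshift 1 i); last exact/val_inj.
by rewrite col_mxEd.
Qed.

Lemma sum_sq_delta {R : realType} {n : nat} (a : 'I_n -> R) (i : 'I_n) :
  \sum_j a j * (delta_mx i 0 : 'cV[R]_n) j 0 ^+ 2 = a i.
Proof.
rewrite (bigD1 i) //= big1 => [|j /negPf ji].
  by rewrite mxE !eqxx addr0 expr1n mulr1.
by rewrite mxE ji /= expr0n mulr0.
Qed.

(** * Information matrices *)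
Lemma info_matrix_linear_change {R : realType} {nu p : nat}
    {X : {pred 'cV[R]_nu}} (f g : 'cV[R]_nu -> 'cV[R]_p) (F : 'M[R]_p)
    (u : 'cV[R]_nu -> 'cV[R]_p -> R) (beta : 'cV[R]_p) (xi : design X) :
  (forall x, f x = F *m g x) ->
  info_matrix f u xi beta = F *m info_matrix g u xi beta *m F^T.
Proof.
move=> fE; rewrite /info_matrix mulmx_sumr mulmx_suml; apply: eq_bigr => i _.
by rewrite fE trmx_mul -scalemxAr -scalemxAl !mulmxA.
Qed.

Lemma psd_info_matrix {R : realType} {nu p : nat} {X : {pred 'cV[R]_nu}}
    (f : 'cV[R]_nu -> 'cV[R]_p) (u : 'cV[R]_nu -> 'cV[R]_p -> R)
    (beta : 'cV[R]_p) (xi : design X) :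
  (forall x, x \in X -> 0 <= u x beta) -> psd (info_matrix f u xi beta).
Proof.
move=> u_ge0; split.
  rewrite /info_matrix raddf_sum; apply: eq_bigr => i _.
  by apply/matrixP => k l; rewrite !mxE !big_ord1 !mxE [f _ k _ * _]mulrC.
move=> v; rewrite /info_matrix mulmx_sumr mulmx_suml summxE.
apply: sumr_ge0 => i _; rewrite -scalemxAr -scalemxAl mxE.
apply: mulr_ge0.
  by rewrite mulr_ge0 ?u_ge0 ?design_point_in // ltW ?design_weight_gt0.
set y := f _.
have -> : v^T *m (y *m y^T) *m v = (y^T *m v)^T *m (y^T *m v).
  by rewrite trmx_mul trmxK !mulmxA.
by rewrite mxE big_ord1 mxE -expr2 sqr_ge0.
Qed.

(** The design [(1 - e) xi + e delta_x].  The point [x] has to be new, since the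
support points of a design are distinct. *)
Lemma mix_design_with_point {R : realType} {nu : nat}
    {X : {pred 'cV[R]_nu}} (xi : design X) (x : 'cV[R]_nu) (e : R) :
  x \in X -> (forall i, design_point xi i != x) -> 0 < e -> e < 1 ->
  exists xi' : design X,
    forall (p : nat) (f : 'cV[R]_nu -> 'cV[R]_p)
      (u : 'cV[R]_nu -> 'cV[R]_p -> R) (beta : 'cV[R]_p),
    info_matrix f u xi' beta
      = (1 - e) *: info_matrix f u xi beta
        + (e * u x beta) *: (f x *m (f x)^T).
Proof.
move=> xX x_new e_gt0 e_lt1.
pose pt (i : 'I_(design_size xi).+1) :=
  if unlift ord0 i is Some j then design_point xi j else x.
pose wt (i : 'I_(design_size xi).+1) :=
  if unlift ord0 i is Some j then (1 - e) * design_weight xi j else e.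
have pt_inj : injective pt.
  move=> i j; rewrite /pt.
  case: unliftP => [i' ->|->]; case: unliftP => [j' ->|->] //.
  - by move/design_point_inj ->.
  - by move/eqP; rewrite (negPf (x_new _)).
  - by move/esym/eqP; rewrite (negPf (x_new _)).
have pt_in i : pt i \in X.
  by rewrite /pt; case: unliftP => // j _; exact: design_point_in.
have wt_gt0 i : 0 < wt i.
  rewrite /wt; case: unliftP => // j _.
  by rewrite mulr_gt0 ?subr_gt0 ?design_weight_gt0.
have wt_sum : \sum_i wt i = 1.
  rewrite big_ord_recl {1}/wt unlift_none.
  under eq_bigr => i _ do rewrite /wt liftK.
  by rewrite -mulr_sumr design_weight_sum mulr1 addrC subrK.
exists (Design pt_inj pt_in wt_gt0 wt_sum) => p f u beta.
rewrite /info_matrix /= big_ord_recl addrC; congr (_ + _).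
  rewrite scaler_sumr; apply: eq_bigr => i _.
  by rewrite /pt /wt !liftK scalerA mulrA.
by rewrite /pt /wt !unlift_none.
Qed.

Lemma info_matrix_xi_star {R : realType} {nu : nat}
    (u : 'cV[R]_nu -> 'cV[R]_(1 + nu) -> R) (beta : 'cV[R]_(1 + nu)) :
  info_matrix barycentric u (xi_star R nu) beta
    = diag_mx (\row_(i < nu.+1) (nu.+1%:R^-1 * u (xstar R i) beta)).
Proof.
rewrite /info_matrix /= diag_mx_sum_delta; apply: eq_bigr => i _.
by rewrite barycentric_xstar mxE trmx_delta mul_delta_mx.
Qed.

(** * The upper bound for the determinant *)
Lemma prod_le_mean {R : realFieldType} {n : nat} (a : 'I_n.+1 -> R) :
  (forall i, 0 <= a i) -> \sum_i a i <= 1 -> \prod_i a i <= n.+1%:R^-1 ^+ n.+1.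
Proof.
move=> a_ge0 sum_le1.
have := @leif_AGM R _ predT a (fun i _ => a_ge0 i).
rewrite cardT size_enum_ord => -[le_mean _].
have mean_le : (\sum_i a i) / n.+1%:R <= n.+1%:R^-1.
  by rewrite ler_piMl // invr_ge0 ler0n.
apply: le_trans le_mean _; apply: lerXn2r mean_le.
  by rewrite nnegrE divr_ge0 ?sumr_ge0.
by rewrite nnegrE invr_ge0.
Qed.

(** The diagonal entries of the information matrix, divided by the [a i], add up
to the average over the design of [u] times the left-hand side of the hypothesis;
so they add up to at most 1, and their product is largest when all are equal.
Hadamard's inequality passes from the product to the determinant. *)
Lemma det_info_matrix_le {R : realType} {nu p : nat} {X : {pred 'cV[R]_nu}}
    (f : 'cV[R]_nu -> 'cV[R]_p.+1) (u : 'cV[R]_nu -> 'cV[R]_p.+1 -> R)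
    (beta : 'cV[R]_p.+1) (a : 'I_p.+1 -> R) (xi : design X) :
  (forall i, 0 < a i) -> (forall x, x \in X -> 0 < u x beta) ->
  (forall x, x \in X ->
     \sum_i (a i)^-1 * f x i 0 ^+ 2 <= (u x beta)^-1) ->
  \det (info_matrix f u xi beta) <= \prod_i (p.+1%:R^-1 * a i).
Proof.
move=> a_gt0 u_gt0 var_le; set M := info_matrix _ _ _ _.
have psdM : psd M by apply: psd_info_matrix => x /u_gt0/ltW.
have /andP[_ detM_le] := hadamard_inequality M psdM.
apply: le_trans detM_le _.
have ratio_ge0 i : 0 <= (a i)^-1 * M i i.
  by rewrite mulr_ge0 ?psd_diag_ge0 // invr_ge0 ltW.
have sum_ratio : \sum_i (a i)^-1 * M i i <= 1.
  rewrite -(design_weight_sum xi).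
  have -> : \sum_i (a i)^-1 * M i i = \sum_k design_weight xi k *
      (u (design_point xi k) beta
        * \sum_i (a i)^-1 * f (design_point xi k) i 0 ^+ 2).
    under eq_bigr => i _ do rewrite summxE mulr_sumr.
    rewrite exchange_big; apply: eq_bigr => k _.
    rewrite !mulr_sumr; apply: eq_bigr => i _.
    by rewrite !mxE big_ord1 !mxE; ring.
  apply: ler_sum => k _.
  rewrite ler_piMr ?(ltW (design_weight_gt0 k)) //.
  have xk := design_point_in k.
  by rewrite mulrC -ler_pdivlMr ?u_gt0 // div1r var_le.
have -> : \prod_i M i i = (\prod_i a i) * \prod_i ((a i)^-1 * M i i).
  rewrite -big_split; apply: eq_bigr => i _ /=.
  by rewrite mulVKf // gt_eqF.
rewrite [leRHS]big_split /= prodr_const card_ord mulrC.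
by rewrite ler_wpM2r ?prod_le_mean // prodr_ge0 // => i _; rewrite ltW.
Qed.

(** * Mass moved to a point that violates the condition *)
Lemma bernoulli_inequality {R : realDomainType} (n : nat) (e : R) :
  e <= 1 -> 1 - n%:R * e <= (1 - e) ^+ n.
Proof.
move=> e_le1; elim: n => [|n IHn]; first by rewrite mul0r subr0.
have ne2 : 0 <= n%:R * e ^+ 2 by rewrite mulr_ge0 ?sqr_ge0.
have := ler_wpM2l (_ : 0 <= 1 - e) IHn; rewrite -exprS subr_ge0 => /(_ e_le1).
apply: le_trans; rewrite -natr1; nra.
Qed.

(** The factor by which the determinant changes when mass [e] is moved to a point
where [u] times the sum of squares equals [d]; the matrix has size [n + 1]. *)
Lemma exists_det_increase {R : realFieldType} (n : nat) (d : R) : 1 < d ->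
  exists e : R, [/\ 0 < e, e < 1 &
    1 < (1 - e) ^+ n.+1 * (1 + e / (1 - e) * (n.+1%:R * d))].
Proof.
move=> d_gt1; have p_gt0 : 0 < n.+1%:R :> R by rewrite ltr0n.
have n_ge0 : 0 <= n%:R :> R by [].
(* With [e (n + 1) d = d - 1] the factor is [(1 - e)^n (d - e)], and
   [(1 - n e) (d - e) = 1 + e (d - 1) + n e^2 > 1]. *)
pose e := (d - 1) / (n.+1%:R * d); exists e.
have eE : e * (n.+1%:R * d) = d - 1 by rewrite divfK //; apply: lt0r_neq0; nra.
have e_gt0 : 0 < e by rewrite divr_gt0 //; nra.
have e_lt1 : e < 1.
  by rewrite ltr_pdivrMr ?mul1r -?natr1; nra.
split=> //.
have -> : (1 - e) ^+ n.+1 * (1 + e / (1 - e) * (n.+1%:R * d))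
    = (1 - e) ^+ n * (d - e).
  rewrite exprSr -mulrA; congr (_ * _).
  rewrite mulrDr mulr1 [_ / _ * _]mulrAC eE [(1 - e) * _]mulrC divfK; first by ring.
  by rewrite subr_eq0 gt_eqF.
have de_gt0 : 0 < d - e by lra.
have := bernoulli_inequality n e (ltW e_lt1).
rewrite -(ler_pM2r de_gt0); apply: lt_le_trans.
move: eE; rewrite -natr1; nra.
Qed.

Theorem theorem5p3 (R : realType) (nu : nat) (hnu : (2 <= nu)%N)
    (u : 'cV[R]_nu -> 'cV[R]_(1 + nu) -> R)
    (hu : glm_intensity (hypercube R nu) (@first_order_regression R nu) u)
    (beta : 'cV[R]_(1 + nu)) :
  locally_D_optimal (@first_order_regression R nu) u beta (xi_star R nu) <->
  (forall x : 'cV[R]_nu, x \in hypercube R nu ->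
     (u (xstar R ord0) beta)^-1 * (1 - \sum_(j < nu) x j 0) ^+ 2
     + \sum_(i < nu) (u (xstar R (lift ord0 i)) beta)^-1 * x i 0 ^+ 2
     <= (u x beta)^-1).
Proof.
have u_gt0 x : x \in hypercube R nu -> 0 < u x beta by exact: (proj1 hu).
pose a (i : 'I_nu.+1) := u (xstar R i) beta.
have a_gt0 i : 0 < a i by rewrite u_gt0 ?xstar_in.
pose N (xi : design (hypercube R nu)) := info_matrix barycentric u xi beta.
pose q : R := nu.+1%:R^-1.
have q_gt0 : 0 < q by rewrite invr_gt0 ltr0n.
have detM xi :
    \det (info_matrix (@first_order_regression R nu) u xi beta) = \det (N xi).
  rewrite (info_matrix_linear_change _ _ _ _ _ _ first_order_regressionE).
  by rewrite !det_mulmx det_tr det_simplex_mx mul1r mulr1.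
have det_star : \det (N (xi_star R nu)) = \prod_i (q * a i).
  by rewrite /N info_matrix_xi_star det_diag; apply: eq_bigr => i _; rewrite mxE.
have det_star_gt0 : 0 < \det (N (xi_star R nu)).
  by rewrite det_star prodr_gt0 // => i _; rewrite mulr_gt0.
(* Information matrices are positive semidefinite, so a singular one has
   determinant zero and may be admitted to the comparison. *)
have optE : locally_D_optimal (@first_order_regression R nu) u beta
      (xi_star R nu) <-> forall xi, \det (N xi) <= \det (N (xi_star R nu)).
  rewrite /locally_D_optimal unitmxE unitfE detM gt_eqF //.
  have detN_ge0 xi : 0 <= \det (N xi).
    have psdN : psd (N xi) by apply: psd_info_matrix => x /u_gt0/ltW.
    by case/andP: (hadamard_inequality _ psdN).
  split=> [[_ opt] xi | le_det].
    have [->|N_neq0] := eqVneq (\det (N xi)) 0; first exact: ltW.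
    have := opt xi; rewrite unitmxE unitfE !det_inv !detM => /(_ N_neq0).
    by rewrite lef_pV2 ?posrE // lt_def N_neq0 detN_ge0.
  split=> // xi; rewrite unitmxE unitfE !det_inv !detM => N_neq0.
  by rewrite lef_pV2 ?posrE // lt_def N_neq0 detN_ge0.
rewrite optE; split=> [opt x xX | var_le xi]; last first.
  rewrite det_star; apply: (det_info_matrix_le _ _ _ a) => // x xX.
  by rewrite sum_inv_barycentric var_le.
rewrite -(sum_inv_barycentric a).
have [/existsP[i /eqP <-]|/existsPn x_new] :=
    boolP [exists i, xstar R i == x].
  by rewrite barycentric_xstar sum_sq_delta.
rewrite leNgt; apply/negP; set s := \sum_i _ => s_gt.
have d_gt1 : 1 < u x beta * s.
  by rewrite mulrC -ltr_pdivrMr ?u_gt0 // div1r.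
have [e [e_gt0 e_lt1 increase]] := exists_det_increase nu _ d_gt1.
have [xi xiE] := mix_design_with_point (xi_star R nu) x e xX x_new e_gt0 e_lt1.
have := opt xi; apply/negP; rewrite -ltNge.
have ne_gt0 : 0 < 1 - e by rewrite subr_gt0.
pose w : 'rV[R]_(1 + nu) := \row_(i < nu.+1) ((1 - e) * (q * a i)).
have -> : N xi = diag_mx w
    + (e * u x beta) *: (barycentric x *m (barycentric x)^T).
  rewrite /N xiE info_matrix_xi_star; congr (_ + _).
  by apply/matrixP => i j; rewrite !mxE mulrnAr.
rewrite det_diag_add_rank1 => [|i]; last first.
  by rewrite mxE lt0r_neq0 // !mulr_gt0.
have -> : \prod_i w 0 i = (1 - e) ^+ nu.+1 * \det (N (xi_star R nu)).
  under eq_bigr => i _ do rewrite mxE.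
  by rewrite big_split /= prodr_const card_ord det_star.
have -> : \sum_i (w 0 i)^-1 * barycentric x i 0 ^+ 2
    = (1 - e)^-1 * (nu.+1%:R * s).
  rewrite /s !mulr_sumr; apply: eq_bigr => i _.
  by rewrite mxE !invfM /q invrK !mulrA.
rewrite -mulrA mulrCA ltr_pMr //.
apply: lt_le_trans increase _; rewrite le_eqVlt; apply/orP; left; apply/eqP.
by congr (_ * (1 + _)); ring.
Qed.
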